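(* Let $Y=(X,\{R_i\}_{0\le i\le D})$ be a symmetric $D$-class association scheme which is bipartite $P$-polynomial, and which is $Q$-polynomial with respect to an ordering $E_0,E_1,\dots,E_D$ of its primitive idempotents. Let $m_i=\operatorname{rank}(E_i)$ $(0\le i\le D)$ be the corresponding multiplicities. Then the sequence $m_0,m_1,\dots,m_D$ is unimodal, i.e. there is an index $k\in\{0,\dots,D\}$ such that $m_0\le m_1\le\cdots\le m_k\ge m_{k+1}\ge\cdots\ge m_D$.
   Context: Symmetric association scheme. A symmetric $D$-class association scheme ($D\ge 1$) is a pair $Y=(X,\{R_i\}_{0\le i\le D})$ where $X$ is a finite nonempty set and $R_0,\dots,R_D$ are nonempty symmetric relations partitioning $X\times X$, with $R_0=\{(x,x):x\in X\}$, such that for all $h,i,j$ there is a number $p^h_{ij}$ with $|\{z\in X:(x,z)\in R_i,\ (z,y)\in R_j\}|=p^h_{ij}$ for every $(x,y)\in R_h$. The associate matrices $A_0,\dots,A_D$ are the $0/1$ matrices with rows and columns indexed by $X$ and $(A_i)_{xy}=1$ if and only if $(x,y)\in R_i$. Their complex span $M$ is a commutative algebra of dimension $D+1$, closed under the entrywise product $\circ$. It has a unique basis (up to order) of primitive idempotents, i.e. matrices $E_0,\dots,E_D$ with $E_iE_j=\delta_{ij}E_i$ and $\sum_i E_i=I$; in any ordering $E_0,\dots,E_D$ it is understood that $E_0=|X|^{-1}J$, where $J$ is the all-ones matrix. The multiplicity $m_i$ is $\operatorname{rank}(E_i)$. $P$-polynomial and bipartite. $Y$ is $P$-polynomial with respect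 to the ordering $R_0,\dots,R_D$ of the associate classes if for all $h,i,j\in\{0,\dots,D\}$: $p^h_{ij}=0$ whenever one of $h,i,j$ is greater than the sum of the other two, and $p^h_{ij}\neq 0$ whenever one of $h,i,j$ equals the sum of the other two. ''Bipartite $P$-polynomial'' means that the classes can be ordered $R_0,\dots,R_D$ so that $Y$ is $P$-polynomial with respect to this ordering and the graph with vertex set $X$ and edge relation $R_1$ is bipartite. $Q$-polynomial. The Krein parameters $q^h_{ij}$ are defined by $E_i\circ E_j=|X|^{-1}\sum_{h=0}^D q^h_{ij}E_h$. $Y$ is $Q$-polynomial with respect to the ordering $E_0,\dots,E_D$ if for all $h,i,j\in\{0,\dots,D\}$: $q^h_{ij}=0$ whenever one of $h,i,j$ is greater than the sum of the other two, and $q^h_{ij}\ne 0$ whenever one of $h,i,j$ equals the sum of the other two. *)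

(* Defs.v *)
From HB Require Import structures.
From mathcomp Require Import all_boot all_order all_algebra all_fingroup.
From mathcomp Require Import complex reals.

Set Implicit Arguments.
Unset Strict Implicit.
Unset Printing Implicit Defensive.

Import GRing.Theory.

Local Open Scope ring_scope.

Record assoc_scheme (X : finType) (D : nat) := AssocScheme {
  cls :> 'I_D.+1 -> rel X;
  inum : 'I_D.+1 -> 'I_D.+1 -> 'I_D.+1 -> nat; (* inum h i j is p^h_{ij} *)
  scheme_classes : (1 <= D)%N;
  scheme_nonempty : (0 < #|X|)%N;
  cls_nonempty : forall i, exists x y, cls i x y;
  cls_sym : forall i x y, cls i x y = cls i y x;
  cls_partition : forall x y, exists! i, cls i x y;
  cls0 : forall x y, cls ord0 x y = (x == y);
  inumP : forall h i j x y, cls h x y ->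
    #|[set z | cls i x z && cls j z y]| = inum h i j
}.

Definition triangle_conditions (T : nmodType) (D : nat)
    (f : 'I_D.+1 -> 'I_D.+1 -> 'I_D.+1 -> T) : Prop :=
  forall h i j : 'I_D.+1,
    ([|| i + j < h, h + j < i | h + i < j]%N -> f h i j = 0) /\
    ([|| h == i + j :> nat, i == h + j :> nat | j == h + i :> nat]%N ->
       f h i j <> 0).

Definition bipartite (X : finType) (e : rel X) : Prop :=
  exists A : {set X}, forall x y, e x y -> (x \in A) != (y \in A).

(* The permutation s encodes the ordering R_(s 0), ..., R_(s D) of the
   classes. *)
Definition P_polynomial (X : finType) (D : nat) (Y : assoc_scheme X D)
    (s : 'S_D.+1) : Prop :=
  triangle_conditions (fun h i j => inum Y (s h) (s i) (s j)).

(* As D >= 1, inord 1 is the index 1. *)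
Definition bipartite_P_polynomial (X : finType) (D : nat)
    (Y : assoc_scheme X D) : Prop :=
  exists s : 'S_D.+1,
    [/\ s ord0 = ord0, P_polynomial Y s & bipartite (Y (s (inord 1)))].

Section Idempotents.

Variables (C : fieldType) (X : finType) (D : nat).
Implicit Type E : 'I_D.+1 -> 'M[C]_#|X|.

Definition assoc_mx (Y : assoc_scheme X D) (i : 'I_D.+1) : 'M[C]_#|X| :=
  \matrix_(x, y) (Y i (enum_val x) (enum_val y))%:R.

Definition bose_mesner (Y : assoc_scheme X D) : {vspace 'M[C]_#|X|} :=
  <<[tuple assoc_mx Y i | i < D.+1]>>%VS.

Definition primitive_idempotents (Y : assoc_scheme X D) E : Prop :=
  [/\ basis_of (bose_mesner Y) [tuple E i | i < D.+1],
      forall i j, E i *m E j = if i == j then E i else 0,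
      \sum_i E i = 1%:M
    & E ord0 = #|X|%:R^-1 *: const_mx 1].

(* q h i j is q^h_{ij}; it is unique when E is linearly independent. *)
Definition krein_parameters E
    (q : 'I_D.+1 -> 'I_D.+1 -> 'I_D.+1 -> C) : Prop :=
  forall i j,
    map2_mx *%R (E i) (E j) = #|X|%:R^-1 *: \sum_h q h i j *: E h.

Definition Q_polynomial E : Prop :=
  exists2 q, krein_parameters E q & triangle_conditions q.

End Idempotents.

Definition unimodal (D : nat) (m : 'I_D.+1 -> nat) : Prop :=
  exists k : 'I_D.+1,
    (forall i j : 'I_D.+1, i <= j <= k -> m i <= m j)%N /\
    (forall i j : 'I_D.+1, k <= i <= j -> m j <= m i)%N.

(* Main.v *)
(** Fix a base vertex and let E^*_0, ..., E^*_D be the diagonal projections onto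
    its distance classes. With A the adjacency matrix and A^* the diagonal matrix
    with entries E_1(x_0, w), A is tridiagonal with respect to the E^*_j and, by
    a vanishing Krein parameter and positivity, A^* is tridiagonal with respect
    to the E_i. Bipartiteness makes |X|^-1 ((-1)^dist(x, y)) a primitive
    idempotent of rank one; the Q-polynomial triangle conditions force it to be
    E_D, so conjugation by the diagonal sign matrix S maps E_i to E_(D-i), and
    m_i = m_(D-i).

    It remains to see m_i <= m_(i+1) for 2i < D. Passing to composition factors
    of the algebra generated by A and A^*, one may assume irreducibility. Let r
    and rho be the smallest indices with E_r and E^*_rho nonzero. The split spaces
    U_k = (E^*_rho + ... + E^*_(rho+k)) n (E_(r+k) + ... + E_D) span an invariant
    subspace, hence everything, while the analogous spaces with r replaced by r+1
    span an invariant proper subspace, hence vanish. Counting dimensions,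
    dim U_k = rank E_(r+k). Finally A - theta_(r+k) maps U_k to U_(k+1), and S
    maps its kernel into a vanishing space when 2(r+k) < D. *)

Require Import Defs.
From HB Require Import structures.
From mathcomp Require Import all_boot all_order all_algebra all_fingroup.
From mathcomp Require Import complex reals.
From mathcomp Require Import zify.

Set Implicit Arguments.
Unset Strict Implicit.
Unset Printing Implicit Defensive.

Import Order.TTheory GRing.Theory Num.Theory.

Local Open Scope ring_scope.

(** * Orthogonal idempotents *)

Definition spectral (F : fieldType) (n D : nat) (f : nat -> F)
    (E : nat -> 'M[F]_n) : 'M[F]_n :=
  \sum_(i < D.+1) f i *: E i.

(** Indexing by [nat] keeps [i.+1] and [D - i] free of bound proofs; the two conditions force
    [E i = 0] beyond [D]. Members may vanish, so that the notion survives restriction to invariant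
    subspaces. *)
Definition idem_system (F : fieldType) (n D : nat)
    (E : nat -> 'M[F]_n) : Prop :=
  (forall i j, E i *m E j = if i == j then E i else 0) /\
  \sum_(i < D.+1) E i = 1%:M.

Section IdemSystem.

Variables (F : fieldType) (n D : nat) (E : nat -> 'M[F]_n).
Hypothesis idE : idem_system D E.

Lemma idem_mul i j : E i *m E j = if i == j then E i else 0.
Proof. by case: idE. Qed.

Lemma idem_sum : \sum_(i < D.+1) E i = 1%:M.
Proof. by case: idE. Qed.

Lemma mulmx_idem_sum m (u : 'M_(m, n)) : u = \sum_(i < D.+1) u *m E i.
Proof. by rewrite -mulmx_sumr idem_sum mulmx1. Qed.

Lemma idem_out i : (D < i)%N -> E i = 0.
Proof.
move=> Di; rewrite (mulmx_idem_sum (E i)) big1 // => j _.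
by rewrite idem_mul; case: eqP => // ij; have := ltn_ord j; lia.
Qed.

Lemma idem_eq0 m (u : 'M_(m, n)) : (forall i, u *m E i = 0) -> u = 0.
Proof. by move=> u0; rewrite (mulmx_idem_sum u) big1. Qed.

Lemma spectral_mulr f i : (i <= D)%N -> spectral D f E *m E i = f i *: E i.
Proof.
move=> iD; rewrite mulmx_suml (bigD1 (Ordinal (iD : (i < D.+1)%N))) //=.
rewrite -scalemxAl idem_mul eqxx big1 ?addr0 // => j /eqP ji.
rewrite -scalemxAl idem_mul; case: eqP => [e|]; last by rewrite scaler0.
by case: ji; apply: val_inj.
Qed.

Lemma spectral_mul f g :
  spectral D f E *m spectral D g E = spectral D (fun i => f i * g i) E.
Proof.
rewrite {2}/spectral mulmx_sumr; apply: eq_bigr => i _.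
by rewrite -scalemxAr spectral_mulr -1?ltnS // scalerA mulrC.
Qed.

(** Lagrange interpolation: as the eigenvalues are distinct, [E k] is a polynomial in
    [spectral D th E]. *)
Lemma spectral_stable (th : nat -> F) (U : 'M_n) k :
    (forall i j, (i <= D -> j <= D -> th i = th j -> i = j)%N) ->
    (U *m spectral D th E <= U)%MS -> (U *m E k <= U)%MS.
Proof.
move=> th_inj stA; case: (leqP k D) => kD; last first.
  by rewrite idem_out // mulmx0 sub0mx.
have st s : (U *m spectral D (fun i => \prod_(l <- s) (th i - th l)) E <= U)%MS.
  elim: s => [|a s IH].
    rewrite (_ : spectral _ _ _ = 1%:M) ?mulmx1 // -idem_sum.
    by apply: eq_bigr => i _; rewrite big_nil scale1r.
  have -> : spectral D (fun i => \prod_(l <- a :: s) (th i - th l)) E =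
      spectral D (fun i => th i - th a) E *m
      spectral D (fun i => \prod_(l <- s) (th i - th l)) E.
    by rewrite spectral_mul; apply: eq_bigr => i _; rewrite big_cons.
  rewrite mulmxA; apply: submx_trans IH; apply: submxMr.
  have -> : spectral D (fun i => th i - th a) E = spectral D th E - th a *: 1%:M.
    rewrite -idem_sum scaler_sumr -sumrB.
    by apply: eq_bigr => i _; rewrite scalerBl.
  rewrite mulmxBr -scalemxAr mulmx1; apply: addmx_sub => //.
  by rewrite eqmx_opp scalemx_sub.
(* The product over all [l != k] kills every other eigencomponent and acts on the [k]-th by the
   nonzero scalar [c]. *)
pose s := [seq l <- iota 0 D.+1 | l != k].
pose c := \prod_(l <- s) (th k - th l).
have c0 : c != 0.
  rewrite prodf_seq_neq0; apply/allP => l; rewrite mem_filter mem_iota add0n.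
  case/and3P=> lk _ lD /=; rewrite subr_eq0; apply: contra lk => /eqP e.
  by apply/eqP/esym/th_inj.
have := st s; rewrite /spectral (bigD1 (Ordinal (kD : (k < D.+1)%N))) //= -/c.
rewrite big1 ?addr0 => [|i ik]; last first.
  rewrite (big_rem (val i)) /=; first by rewrite subrr mul0r scale0r.
  by rewrite mem_filter mem_iota add0n ltn_ord andbT ik.
by rewrite -scalemxAr eqmx_scale.
Qed.

(** A vector of [E i] in the sum of the other row spaces is both fixed and killed by [E i], so the
    sum is direct; it is everything because the [E i] add up to the identity. *)
Lemma idem_mxrank_sum : (\sum_(i < D.+1) \rank (E i))%N = n.
Proof.
have dE : mxdirect (\sum_(i < D.+1) E i).
  apply/mxdirect_sumsP => i _; apply/eqP; rewrite -submx0.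
  set v := (_ :&: _)%MS; have vi : (v <= E i)%MS by exact: capmxSl.
  have vk : v *m E i = 0.
    apply/eqP; rewrite -submx0.
    apply: submx_trans (submxMr _ (capmxSr _ _)) _.
    rewrite sumsmxMr; apply/sumsmx_subP => j ji.
    by rewrite idem_mul (negbTE (ji : val j != val i)) sub0mx.
  suff -> : v = v *m E i by rewrite vk sub0mx.
  by case/submxP: vi => w ->; rewrite -mulmxA idem_mul eqxx.
rewrite -(mxdirectP dE) /= -[RHS](mxrank1 F).
apply/eqP; rewrite eqn_leq !mxrankS ?submx1 //.
rewrite -idem_sum; apply: summx_sub => i _.
exact: (sumsmx_sup i).
Qed.

End IdemSystem.

Section Filtration.

Variables (F : fieldType) (n D : nat) (E : nat -> 'M[F]_n).
Hypothesis idE : idem_system D E.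

Definition idem_low m : 'M[F]_n := \sum_(i < m) E i.

Lemma sub_idem_lowP k m (u : 'M_(k, n)) :
  reflect (forall i, (m <= i)%N -> u *m E i = 0) (u <= idem_low m)%MS.
Proof.
apply: (iffP idP) => [|u0].
  case/submxP=> w -> i mi; rewrite -mulmxA mulmx_suml big1 ?mulmx0 // => j _.
  by rewrite (idem_mul idE); case: eqP => // e; have := ltn_ord j; lia.
suff -> : u = u *m idem_low m by exact: submxMl.
rewrite {1}(mulmx_idem_sum idE u) mulmx_sumr.
rewrite -(big_mkord xpredT (fun i => u *m E i)) -(big_mkord xpredT (fun i => u *m E i)).
case: (leqP m D.+1) => mD.
  rewrite (big_cat_nat (leq0n m) mD) /= [X in _ + X]big_nat [X in _ + X]big1 ?addr0 //.
  by move=> i /andP[mi _]; exact: u0.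
rewrite [RHS](big_cat_nat (leq0n D.+1) (ltnW mD)) /=.
rewrite [X in _ = _ + X]big_nat [X in _ = _ + X]big1 ?addr0 //.
by move=> i /andP[mi _]; rewrite (idem_out idE) ?mulmx0.
Qed.

Definition idem_high m : 'M[F]_n := 1%:M - \sum_(i < m) E i.

Lemma sub_idem_highP k m (u : 'M_(k, n)) :
  reflect (forall i, (i < m)%N -> u *m E i = 0) (u <= idem_high m)%MS.
Proof.
apply: (iffP idP) => [|u0].
  case/submxP=> w -> i im; rewrite -mulmxA mulmxBl mul1mx mulmx_suml.
  rewrite (bigD1 (Ordinal im)) //= (idem_mul idE) eqxx big1 ?addr0 ?subrr ?mulmx0 //.
  move=> j /eqP ji; rewrite (idem_mul idE); case: eqP => // e.
  by case: ji; apply: val_inj.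
suff -> : u = u *m idem_high m by exact: submxMl.
by rewrite mulmxBr mulmx1 mulmx_sumr big1 ?subr0 // => i _; exact: u0.
Qed.

End Filtration.

(** * Tridiagonal systems *)

(** All conditions pass to invariant subspaces and to transposes, which permits induction on [n]. In
    the application [spectral D eps Es] is the sign matrix. *)
Record td_system (F : fieldType) (n D : nat) (th ths eps : nat -> F)
    (E Es : nat -> 'M[F]_n) : Prop := TdSystem {
  td_E : idem_system D E;
  td_Es : idem_system D Es;
  td_A : forall i j, (i.+1 < j)%N || (j.+1 < i)%N ->
    Es i *m spectral D th E *m Es j = 0;
  td_B : forall i j, (i.+1 < j)%N || (j.+1 < i)%N ->
    E i *m spectral D ths Es *m E j = 0;
  td_S : forall i, (i <= D)%N ->
    spectral D eps Es *m E i = E (D - i)%N *m spectral D eps Es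
}.

Lemma trmx_spectral (F : fieldType) (n D : nat) (f : nat -> F)
    (E : nat -> 'M[F]_n) :
  (spectral D f E)^T = spectral D f (fun i => (E i)^T).
Proof. by rewrite /spectral linear_sum /=; apply: eq_bigr => i _; rewrite linearZ. Qed.

Lemma trmx_idem_system (F : fieldType) (n D : nat) (E : nat -> 'M[F]_n) :
  idem_system D E -> idem_system D (fun i => (E i)^T).
Proof.
case=> idE sumE; split=> [i j|]; last by rewrite -linear_sum sumE /= trmx1.
by rewrite -trmx_mul idE eq_sym; case: eqP => [->|]; rewrite ?trmx0.
Qed.

Lemma trmx_td_system (F : fieldType) (n D : nat) (th ths eps : nat -> F)
    (E Es : nat -> 'M[F]_n) :
  td_system D th ths eps E Es ->
  td_system D th ths eps (fun i => (E i)^T) (fun i => (Es i)^T).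
Proof.
case=> idE idEs hA hB hS; split; try exact: trmx_idem_system.
- move=> i j ij; rewrite -trmx_spectral -trmx_mul -trmx_mul mulmxA hA ?trmx0 //.
  by rewrite orbC.
- move=> i j ij; rewrite -trmx_spectral -trmx_mul -trmx_mul mulmxA hB ?trmx0 //.
  by rewrite orbC.
- move=> i iD; rewrite -trmx_spectral -!trmx_mul hS ?leq_subr //.
  by rewrite subKn.
Qed.

(** * Restriction to invariant subspaces and their annihilators *)

Section SubSystem.

Variables (F : fieldType) (n D : nat) (th ths eps : nat -> F).
Variables (E Es : nat -> 'M[F]_n) (U : 'M[F]_n).
Hypothesis sysE : td_system D th ths eps E Es.
Hypothesis stE : forall i, (U *m E i <= U)%MS.
Hypothesis stEs : forall i, (U *m Es i <= U)%MS.

Let K := row_base U.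

(** The matrix, in the basis [K], of the map induced by [M] on the row space of [U] when this space
    is invariant. *)
Definition restrict_mx (M : 'M[F]_n) : 'M[F]_(\rank U) := K *m M *m pinvmx K.

Lemma restrict_mxE M : (U *m M <= U)%MS -> K *m M = restrict_mx M *m K.
Proof.
move=> st; rewrite /restrict_mx mulmxKpV //.
have e := eq_row_base U; rewrite -/K in e.
by rewrite e (eqmxMr M e).
Qed.

Lemma restrict_inj (M N : 'M_(\rank U)) : M *m K = N *m K -> M = N.
Proof. exact/row_free_inj/row_base_free. Qed.

Lemma restrict_mul M N : (U *m M <= U)%MS -> (U *m N <= U)%MS ->
  restrict_mx (M *m N) = restrict_mx M *m restrict_mx N.
Proof.
move=> sM sN; apply: restrict_inj; rewrite -restrict_mxE; last first.
  by rewrite mulmxA; apply: submx_trans (submxMr _ sM) sN.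
rewrite mulmxA (restrict_mxE sM) -(mulmxA (restrict_mx M)) (restrict_mxE sN).
by rewrite mulmxA.
Qed.

Lemma restrict_spectral f (G : nat -> 'M_n) :
  restrict_mx (spectral D f G) = spectral D f (fun i => restrict_mx (G i)).
Proof.
rewrite /restrict_mx /spectral mulmx_sumr mulmx_suml; apply: eq_bigr => i _.
by rewrite -scalemxAr -scalemxAl.
Qed.

Lemma restrict_mx0 : restrict_mx 0 = 0.
Proof. by rewrite /restrict_mx mulmx0 mul0mx. Qed.

Lemma restrict_idem_system (G : nat -> 'M_n) :
  idem_system D G -> (forall i, (U *m G i <= U)%MS) ->
  idem_system D (fun i => restrict_mx (G i)).
Proof.
move=> idG stG; split=> [i j|].
  rewrite -restrict_mul // (idem_mul idG); case: eqP => // _.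
  exact: restrict_mx0.
rewrite /restrict_mx -mulmx_suml -mulmx_sumr (idem_sum idG) mulmx1.
by rewrite mulmxVp // row_base_free.
Qed.

Lemma stable_spectral f (G : nat -> 'M_n) :
  (forall i, (U *m G i <= U)%MS) -> (U *m spectral D f G <= U)%MS.
Proof.
move=> stG; rewrite mulmx_sumr; apply: summx_sub => i _.
by rewrite -scalemxAr scalemx_sub.
Qed.

Lemma stableM M N :
  (U *m M <= U)%MS -> (U *m N <= U)%MS -> (U *m (M *m N) <= U)%MS.
Proof. by move=> sM sN; rewrite mulmxA; apply: submx_trans (submxMr _ sM) sN. Qed.

Lemma restrict_td_system :
  td_system D th ths eps (fun i => restrict_mx (E i)) (fun i => restrict_mx (Es i)).
Proof.
case: sysE => idE idEs hA hB hS.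
have sA f := stable_spectral f stE; have sB f := stable_spectral f stEs.
split; try exact: restrict_idem_system.
- move=> i j ij; rewrite -restrict_spectral -!restrict_mul ?hA ?restrict_mx0 //.
  exact: stableM.
- move=> i j ij; rewrite -restrict_spectral -!restrict_mul ?hB ?restrict_mx0 //.
  exact: stableM.
- by move=> i iD; rewrite -restrict_spectral -!restrict_mul ?hS.
Qed.

Lemma restrict_rank M : (U *m M <= U)%MS -> \rank (restrict_mx M) = \rank (U *m M).
Proof.
move=> st; rewrite -(mxrankMfree _ (row_base_free U)) -/K -restrict_mxE //.
by rewrite (eqmxMr M (eq_row_base U)).
Qed.

End SubSystem.

(* The transposed annihilator of U plays the role of the quotient by U. *)
Lemma rank_restrict_annihilator (F : fieldType) (n : nat) (U M : 'M[F]_n) :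
  M *m M = M -> (U *m M <= U)%MS ->
  \rank M = (\rank (U *m M) + \rank ((cokermx U)^T *m M^T))%N.
Proof.
move=> idM st; rewrite -(mxrank_mul_ker M (cokermx U)) addnC.
congr (_ + _)%N; last by rewrite -trmx_mul mxrank_tr.
apply/eqP; rewrite eqn_leq; apply/andP; split; apply: mxrankS; last first.
  by rewrite sub_capmx submxMl; apply/sub_kermxP/eqP; rewrite -submxE.
set v := (_ :&: _)%MS.
have vM : v *m M = v.
  have /submxP[w ->] : (v <= M)%MS by exact: capmxSl.
  by rewrite -mulmxA idM.
rewrite -vM; apply: submxMr; rewrite submxE; apply/eqP/sub_kermxP.
exact: capmxSr.
Qed.

Lemma tr_cokermxE (F : fieldType) (n : nat) (U : 'M[F]_n) :
  ((cokermx U)^T :=: kermx U^T)%MS.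
Proof.
apply/eqmxP; rewrite -mxrank_leqif_eq; last first.
  by apply/sub_kermxP; rewrite -trmx_mul mulmx_coker trmx0.
by rewrite mxrank_tr mxrank_coker mxrank_ker mxrank_tr.
Qed.

Lemma stable_annihilator (F : fieldType) (n : nat) (U M : 'M[F]_n) :
  (U *m M <= U)%MS -> ((cokermx U)^T *m M^T <= (cokermx U)^T)%MS.
Proof.
case/submxP=> W UM; rewrite tr_cokermxE; apply/sub_kermxP.
by rewrite -mulmxA -trmx_mul UM -trmx_mul -mulmxA mulmx_coker mulmx0 trmx0.
Qed.

(** * The split decomposition *)

Section SplitDecomposition.

Variables (F : fieldType) (n D : nat) (th ths eps : nat -> F).
Variables (E Es : nat -> 'M[F]_n).
Hypothesis sysE : td_system D th ths eps E Es.

Let A := spectral D th E.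
Let B := spectral D ths Es.
Let idE := td_E sysE.
Let idEs := td_Es sysE.

(** The split space U_k is the case [m = rho + k.+1], [l = r + k]; vectors are rows, acted on from
    the right. *)
Definition split_mx m l : 'M[F]_n := (idem_low Es m :&: idem_high E l)%MS.

Lemma sub_split_mxP k m l (u : 'M_(k, n)) :
  reflect ((forall i, (m <= i)%N -> u *m Es i = 0) /\
           (forall i, (i < l)%N -> u *m E i = 0)) (u <= split_mx m l)%MS.
Proof.
rewrite sub_capmx; apply: (iffP andP) => -[].
  by move=> /(sub_idem_lowP idEs) ? /(sub_idem_highP idE).
by move=> ? ?; split; [exact/(sub_idem_lowP idEs)|exact/(sub_idem_highP idE)].
Qed.

(** [A] moves dual indices by at most one, and [A - th l] kills the lowest eigencomponent [l]. *)
Lemma split_raise m l :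
  (split_mx m l *m (A - th l *: 1%:M) <= split_mx m.+1 l.+1)%MS.
Proof.
set u := split_mx m l; have /sub_split_mxP[uEs uE] : (u <= u)%MS by [].
apply/sub_split_mxP; rewrite mulmxBr -scalemxAr mulmx1; split=> i hi.
  rewrite mulmxBl -scalemxAl uEs ?(ltnW hi) // scaler0 subr0.
  rewrite (mulmx_idem_sum idEs u) !mulmx_suml big1 // => j _.
  case: (leqP m j) => mj; first by rewrite uEs // !mul0mx.
  rewrite -(mulmxA u) -(mulmxA u) (td_A sysE) ?mulmx0 //; lia.
rewrite mulmxBl -scalemxAl; case: (leqP i D) => iD; last first.
  by rewrite (idem_out idE iD) !mulmx0 scaler0 subrr.
rewrite -mulmxA spectral_mulr // -scalemxAr -scalerBl.
case: (ltngtP i l) => il; [|lia|]; last by rewrite il subrr scale0r.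
by rewrite uE ?scaler0.
Qed.

(** Dually, [B] moves eigenspace indices by at most one, and [B - ths m] kills the top dual
    component [m]. For [l = 0] the truncated [l.-1] imposes nothing. *)
Lemma split_lower m l :
  (split_mx m.+1 l *m (B - ths m *: 1%:M) <= split_mx m l.-1)%MS.
Proof.
set u := split_mx m.+1 l; have /sub_split_mxP[uEs uE] : (u <= u)%MS by [].
apply/sub_split_mxP; rewrite mulmxBr -scalemxAr mulmx1; split=> i hi.
  rewrite mulmxBl -scalemxAl; case: (leqP i D) => iD; last first.
    by rewrite (idem_out idEs iD) !mulmx0 scaler0 subrr.
  rewrite -mulmxA spectral_mulr // -scalemxAr -scalerBl.
  case: (ltngtP i m) => il; [lia| |]; last by rewrite il subrr scale0r.
  by rewrite uEs ?scaler0.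
rewrite mulmxBl -scalemxAl uE ?scaler0 ?subr0; last lia.
rewrite (mulmx_idem_sum idE u) !mulmx_suml big1 // => j _.
case: (ltnP j l) => jl; first by rewrite uE // !mul0mx.
rewrite -(mulmxA u) -(mulmxA u) (td_B sysE) ?mulmx0 //; lia.
Qed.

Lemma split_high0 m l : (D < l)%N -> split_mx m l = 0.
Proof.
move=> Dl; apply: (idem_eq0 idE) => i.
have /sub_split_mxP[_ uE] : (split_mx m l <= split_mx m l)%MS by [].
case: (leqP i D) => iD; first by apply: uE; lia.
by rewrite (idem_out idE iD) mulmx0.
Qed.

Variables (r rho : nat).
Hypothesis rmin : forall i, (i < r)%N -> E i = 0.
Hypothesis rhomin : forall i, (i < rho)%N -> Es i = 0.

(** The shift [e] is 0 for the split spaces and 1 for their analogues with [r] replaced by [r.+1],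
    so that invariance is proved once for both. *)
Definition split_sum e : 'M[F]_n :=
  (\sum_(k < D.+1) split_mx (rho + k.+1) (r + k + e))%MS.

(** No bound on [k] is imposed, as the spaces vanish past [D]; hence raising the last summand does
    not leave the sum. *)
Lemma split_mx_sub_sum e k : (split_mx (rho + k.+1) (r + k + e) <= split_sum e)%MS.
Proof.
case: (leqP k D) => kD; last by rewrite split_high0 ?sub0mx //; lia.
exact: (sumsmx_sup (Ordinal (kD : (k < D.+1)%N))).
Qed.

Lemma split_sum_stableA e : (split_sum e *m A <= split_sum e)%MS.
Proof.
rewrite sumsmxMr; apply/sumsmx_subP => k _; set u := split_mx _ _.
set l := (r + k + e)%N.
have -> : u *m A = u *m (A - th l *: 1%:M) + th l *: u.
  by rewrite mulmxBr -scalemxAr mulmx1 subrK.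
apply: addmx_sub; last by rewrite scalemx_sub // split_mx_sub_sum.
apply: submx_trans (split_raise _ _) _.
by have := split_mx_sub_sum e k.+1; rewrite /l; congr (split_mx _ _ <= _)%MS; lia.
Qed.

Lemma split_sum_stableB e : (split_sum e *m B <= split_sum e)%MS.
Proof.
rewrite sumsmxMr; apply/sumsmx_subP => -[k kD] _ /=; set u := split_mx _ _.
have -> : u *m B = u *m (B - ths (rho + k) *: 1%:M) + ths (rho + k) *: u.
  by rewrite mulmxBr -scalemxAr mulmx1 subrK.
apply: addmx_sub; last by rewrite scalemx_sub // split_mx_sub_sum.
rewrite /u addnS; apply: submx_trans (split_lower _ _) _.
(* For [k = 0] the lowered space has only dual components below [rho], where every [Es i] is
   zero. *)
case: k {kD u} => [|k]; last first.
  by have := split_mx_sub_sum e k; congr (split_mx _ _ <= _)%MS; lia.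
rewrite (_ : split_mx _ _ = 0) ?sub0mx //; apply: (idem_eq0 idEs) => i.
set v := split_mx _ _; have /sub_split_mxP[vEs _] : (v <= v)%MS by [].
case: (leqP rho i) => hi; first by apply: vEs; rewrite addn0.
by rewrite rhomin // mulmx0.
Qed.

(** Every vector of the shifted sum has zero component at the index [r]. *)
Lemma split_sum1_proper : E r != 0 -> (\rank (split_sum 1) < n)%N.
Proof.
move=> Er; rewrite ltn_neqAle rank_leq_col andbT; apply: contra Er => full.
have : (1%:M <= split_sum 1)%MS by rewrite sub1mx.
have : (split_sum 1 <= idem_high E r.+1)%MS.
  apply/sumsmx_subP => k _; apply/(sub_idem_highP idE) => i ir.
  set v := split_mx _ _; have /sub_split_mxP[_ vE] : (v <= v)%MS by [].
  by apply: vE; lia.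
move=> /[swap] /submx_trans /[apply] /(sub_idem_highP idE)/(_ r (ltnSn r)).
by rewrite mul1mx => ->.
Qed.

(** The rows of [Es rho] lie in the first split space, by minimality of [r]. *)
Lemma split_sum0_neq0 : Es rho != 0 -> split_sum 0 != 0.
Proof.
apply: contra => /eqP N0; rewrite -submx0 -N0.
apply: submx_trans (split_mx_sub_sum 0 0); apply/sub_split_mxP; split=> i hi.
  by rewrite (idem_mul idEs); case: eqP => //; lia.
by rewrite rmin ?mulmx0 //; lia.
Qed.

(** * Dimensions of the split spaces in the irreducible case *)

Hypothesis th_inj : forall i j, (i <= D -> j <= D -> th i = th j -> i = j)%N.
Hypothesis eps0 : forall i, eps i != 0.
Hypothesis N1 : split_sum 1 = 0.
Hypothesis N0 : (1%:M <= split_sum 0)%MS.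

(** The trailing [+ 0] keeps [U k] literally a summand of [split_sum 0]. *)
Let U k := split_mx (rho + k.+1) (r + k + 0).

Lemma split_mx1_eq0 k m (u : 'M_(m, n)) :
  (u <= split_mx (rho + k.+1) (r + k + 1))%MS -> u = 0.
Proof.
move/submx_trans/(_ (split_mx_sub_sum 1 k)).
by rewrite N1 submx0 => /eqP.
Qed.

(** [E (r + k)] is injective on [U k]: a vector it kills lies in a shifted space, which is zero. *)
Lemma split_rank_le k : (\rank (U k) <= \rank (E (r + k)))%N.
Proof.
rewrite -(mxrank_mul_ker (U k) (E (r + k))).
rewrite [X in (_ + \rank X)%N](_ : _ = 0) ?mxrank0 ?addn0; last first.
  apply/(@split_mx1_eq0 k); set v := (_ :&: _)%MS.
  have /sub_split_mxP[vEs vE] : (v <= U k)%MS by exact: capmxSl.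
  have /sub_kermxP vk : (v <= kermx (E (r + k)))%MS by exact: capmxSr.
  apply/sub_split_mxP; split=> // i; rewrite addn1 ltnS leq_eqVlt.
  by case/orP=> [/eqP-> //|ik]; apply: vE; rewrite addn0.
by apply: mxrankS; exact: submxMl.
Qed.

(** The ranks of the [E (r + k)] add up to at most [n], while the [U k] span everything; with
    [split_rank_le] termwise, equality holds throughout. *)
Lemma split_rank k : (k <= D)%N -> \rank (U k) = \rank (E (r + k)).
Proof.
move=> kD.
have sumE : (\sum_(k < D.+1) \rank (E (r + k)) <= \sum_(k < D.+1) \rank (U k))%N.
  apply: (@leq_trans n).
    rewrite -[X in (_ <= X)%N](idem_mxrank_sum idE).
    rewrite -(big_mkord xpredT (fun k => \rank (E (r + k)))).
    rewrite -(big_mkord xpredT (fun k => \rank (E k))).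
    have -> : (\sum_(0 <= k < D.+1) \rank (E (r + k)) =
               \sum_(r <= i < D.+1 + r) \rank (E i))%N.
      rewrite -{2}(add0n r) big_addn addnK.
      by apply: eq_bigr => j _; rewrite addnC.
    case: (leqP r D.+1) => rD; last first.
      rewrite big_nat big1 // => i hi; rewrite (idem_out idE) ?mxrank0 //; lia.
    rewrite (big_cat_nat rD) /=; last lia.
    rewrite [X in (_ + X)%N]big_nat [X in (_ + X)%N]big1 ?addn0; last first.
      by move=> i hi; rewrite (idem_out idE) ?mxrank0 //; lia.
    by rewrite [X in (_ <= X)%N](big_cat_nat (leq0n r) rD) /= leq_addl.
  rewrite -[X in (X <= _)%N](mxrank1 F).
  apply: leq_trans (mxrankS N0) _.
  exact: mxrank_sum_leqif.
have := leqif_sum (fun (i : 'I_D.+1) (_ : true) => leqif_geq (split_rank_le i)).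
move=> [le]; rewrite eqn_leq le /= => e.
have := sumE; rewrite e => /forallP/(_ (Ordinal (kD : (k < D.+1)%N))) /= h.
by apply/eqP; rewrite eqn_leq split_rank_le.
Qed.

(** A vector of [U k] killed by [M] lies in the eigenspace [r + k]. The sign matrix keeps its dual
    support and moves it to the eigenspace [D - (r + k)], beyond [r + k], hence into a shifted
    space. *)
Lemma split_raise_inj k : (2 * (r + k) < D)%N -> (\rank (U k) <= \rank (U k.+1))%N.
Proof.
move=> kD; set M := A - th (r + k) *: 1%:M.
rewrite -(mxrank_mul_ker (U k) M).
rewrite [X in (_ + \rank X)%N](_ : _ = 0) ?mxrank0 ?addn0; last first.
  set v := (_ :&: _)%MS.
  have /sub_split_mxP[vEs vE] : (v <= U k)%MS by exact: capmxSl.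
  have /sub_kermxP vk : (v <= kermx M)%MS by exact: capmxSr.
  have vE0 i : i != (r + k)%N -> v *m E i = 0.
    move=> ik; case: (leqP i D) => iD; last by rewrite (idem_out idE iD) mulmx0.
    have := congr1 (mulmx^~ (E i)) vk.
    rewrite mul0mx -mulmxA mulmxBl -scalemxAl mul1mx spectral_mulr // -scalerBl.
    rewrite -scalemxAr => /eqP; rewrite scaler_eq0 subr_eq0 => /orP[|/eqP//].
    by move=> /eqP/th_inj e; rewrite e ?eqxx // in ik; lia.
  pose S := spectral D eps Es.
  have vS0 : v *m S = 0.
    apply: (@split_mx1_eq0 k); apply/sub_split_mxP; split=> i hi.
      rewrite -mulmxA; case: (leqP i D) => iD; last first.
        by rewrite (idem_out idEs iD) !mulmx0.
      by rewrite spectral_mulr // -scalemxAr vEs // scaler0.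
    rewrite -mulmxA (td_S sysE); last lia.
    by rewrite mulmxA vE0 ?mul0mx //; apply/eqP; lia.
  (* [S] is injective because no [eps i] is zero. *)
  apply: (idem_eq0 idEs) => i.
  case: (leqP i D) => iD; last by rewrite (idem_out idEs iD) mulmx0.
  have := congr1 (mulmx^~ (Es i)) vS0.
  rewrite mul0mx -mulmxA spectral_mulr // -scalemxAr => /eqP.
  by rewrite scaler_eq0 (negbTE (eps0 i)) => /eqP.
apply: mxrankS.
by have := split_raise (rho + k.+1) (r + k); rewrite /M /U !addn0 !addnS.
Qed.

Lemma split_rank_mono k : (2 * (r + k) < D)%N ->
  (\rank (E (r + k)) <= \rank (E (r + k).+1))%N.
Proof.
move=> kD; rewrite -addnS -!split_rank; [exact: split_raise_inj|lia|lia].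
Qed.

End SplitDecomposition.

Lemma idem_min_neq0 (F : fieldType) (n D : nat) (E : nat -> 'M[F]_n) :
  idem_system D E -> (0 < n)%N ->
  exists2 r, E r != 0 & forall i, (i < r)%N -> E i = 0.
Proof.
move=> idE n0.
have ex : exists i, E i != 0.
  case: (pickP (fun i : 'I_D.+1 => E i != 0)) => [i Ei|all0]; first by exists i.
  have := idem_sum idE; rewrite big1 => [|i _]; last first.
    by have /negbT := all0 i; rewrite negbK => /eqP.
  by move/(congr1 mxrank); rewrite mxrank0 mxrank1; lia.
exists (ex_minn ex); case: ex_minnP => // r _ rmin i ir.
by apply/eqP; apply: contraTT ir => /rmin; rewrite -leqNgt.
Qed.

(** Strong induction on the dimension [n]: ranks add along a proper nonzero invariant subspace, and
    when neither split sum provides one, the split decomposition applies. *)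
Theorem td_system_rank_mono (F : fieldType) (n D : nat) (th ths eps : nat -> F)
    (E Es : nat -> 'M[F]_n) (i : nat) :
    (forall i j, (i <= D -> j <= D -> th i = th j -> i = j)%N) ->
    (forall i j, (i <= D -> j <= D -> ths i = ths j -> i = j)%N) ->
    (forall i, eps i != 0) ->
    td_system D th ths eps E Es -> (2 * i < D)%N ->
  (\rank (E i) <= \rank (E i.+1))%N.
Proof.
move=> th_inj ths_inj eps0 + iD.
elim/ltn_ind: n E Es => n IH E Es sys.
(* Both the restriction to N and the annihilator of N are smaller systems. *)
have reduce (N : 'M_n) : (0 < \rank N < n)%N ->
    (N *m spectral D th E <= N)%MS -> (N *m spectral D ths Es <= N)%MS ->
    (\rank (E i) <= \rank (E i.+1))%N.
  move=> /andP[N0 Nn] stA stB.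
  (* Distinct eigenvalues turn invariance under the two spectral matrices into invariance under
     every idempotent. *)
  have stE j := spectral_stable (td_E sys) j th_inj stA.
  have stEs j := spectral_stable (td_Es sys) j ths_inj stB.
  have idm j : E j *m E j = E j by rewrite (idem_mul (td_E sys)) eqxx.
  rewrite (rank_restrict_annihilator (idm i) (stE i)).
  rewrite (rank_restrict_annihilator (idm i.+1) (stE i.+1)).
  apply: leq_add.
    rewrite -!restrict_rank //.
    exact: (IH _ Nn _ _ (restrict_td_system sys stE stEs)).
  have stE' j := stable_annihilator (stE j).
  have stEs' j := stable_annihilator (stEs j).
  rewrite -!restrict_rank //.
  apply: (IH _ _ _ _ (restrict_td_system (trmx_td_system sys) stE' stEs')).
  rewrite mxrank_tr mxrank_coker; lia.
case: (posnP n) => [n0|n0].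
  have := rank_leq_col (E i); lia.
have [r Er rmin] := idem_min_neq0 (td_E sys) n0.
have [rho Erho rhomin] := idem_min_neq0 (td_Es sys) n0.
have stA := split_sum_stableA sys r rho.
have stB := split_sum_stableB sys r rhomin.
have [N1|N1] := eqVneq (split_sum D E Es r rho 1) 0; last first.
  apply: (reduce _ _ (stA 1%N) (stB 1%N)).
  by rewrite lt0n mxrank_eq0 N1 (split_sum1_proper sys).
case: (boolP (1%:M <= split_sum D E Es r rho 0)%MS) => N0; last first.
  apply: (reduce _ _ (stA 0%N) (stB 0%N)).
  rewrite lt0n mxrank_eq0 (split_sum0_neq0 sys) //=.
  by rewrite ltn_neqAle rank_leq_col andbT; rewrite sub1mx in N0.
case: (leqP r i) => ri; last by rewrite rmin // mxrank0.
have := split_rank_mono sys th_inj eps0 N1 N0 (k := (i - r)%N).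
by rewrite subnKC //; exact.
Qed.

(** * Bipartite P- and Q-polynomial schemes *)

(** The coefficient of [f j.+1] in the expansion of [f e1 * f j] is nonzero, so the values at [ord0]
    and [e1] determine all others recursively. It serves both the intersection numbers and the Krein
    parameters. *)
Lemma three_term_separation (F : fieldType) (D : nat)
    (f p : 'I_D.+1 -> 'I_D.+1 -> F) (e1 a b : 'I_D.+1) :
    (forall j k, f e1 k * f j k = \sum_h p h j * f h k) ->
    (forall h j : 'I_D.+1, (j.+1 < h)%N -> p h j = 0) ->
    (forall h j : 'I_D.+1, h = j.+1 :> nat -> p h j != 0) ->
    f ord0 a = f ord0 b -> f e1 a = f e1 b ->
  forall j, f j a = f j b.
Proof.
move=> frec p0 p1 f0 f1 [j jD]; elim/ltn_ind: j jD => -[|j] IH jD.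
  by rewrite (_ : Ordinal jD = ord0) //; apply: val_inj.
have jD' : (j < D.+1)%N by lia.
pose J := Ordinal jD'; pose H := Ordinal jD.
have split k : p H J * f H k =
    f e1 k * f J k - \sum_(h < D.+1 | (h < H)%N) p h J * f h k.
  rewrite frec (bigD1 H) //= (bigID (fun h : 'I_D.+1 => (h < H)%N)) /=.
  rewrite [X in _ + (_ + X)]big1 => [|h /andP[hH lhH]]; last first.
    rewrite p0 ?mul0r // /J /=; move: hH; rewrite -val_eqE /= => hH; lia.
  rewrite addr0 (eq_bigl (fun h : 'I_D.+1 => (h < j.+1)%N)) ?addrK // => h.
  by rewrite -val_eqE /=; lia.
apply: (mulfI (p1 H J erefl)); rewrite !split f1 (IH j) //; congr (_ - _).
by apply: eq_bigr => -[h hD] /= hj; rewrite (IH h).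
Qed.

(** The value 0 beyond [D] is the one [idem_system] forces. *)
Definition extend (V : zmodType) (D : nat) (f : 'I_D.+1 -> V) (i : nat) : V :=
  if (i <= D)%N then f (inord i) else 0.

Lemma extend_ord (V : zmodType) (D : nat) (f : 'I_D.+1 -> V) (i : 'I_D.+1) :
  extend f i = f i.
Proof. by rewrite /extend -ltnS ltn_ord inord_val. Qed.

Lemma extend_idem_system (F : fieldType) (n D : nat) (E : 'I_D.+1 -> 'M[F]_n) :
  (forall i j, E i *m E j = if i == j then E i else 0) ->
  \sum_i E i = 1%:M -> idem_system D (extend E).
Proof.
move=> idE sumE; split=> [i j|].
  rewrite /extend; case: (leqP i D) => iD; case: (leqP j D) => jD;
    rewrite ?mul0mx ?mulmx0; try by case: eqP => //; lia.
  by rewrite idE -val_eqE /= !inordK.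
by rewrite -sumE; apply: eq_bigr => i _; rewrite extend_ord.
Qed.

Lemma extend_spectral (F : fieldType) (n D : nat) (f : nat -> F)
    (E : 'I_D.+1 -> 'M[F]_n) :
  spectral D f (extend E) = \sum_(i < D.+1) f i *: E i.
Proof. by apply: eq_bigr => i _; rewrite extend_ord. Qed.

Section Scheme.

Variables (C : numClosedFieldType) (n D : nat) (d : 'I_n -> 'I_n -> 'I_D.+1).
Variables (p : 'I_D.+1 -> 'I_D.+1 -> 'I_D.+1 -> nat).
Variables (E : 'I_D.+1 -> 'M[C]_n) (q : 'I_D.+1 -> 'I_D.+1 -> 'I_D.+1 -> C).
Variables (P Q : 'I_D.+1 -> 'I_D.+1 -> C).

(** [P] and [Q] are the transition matrices between these matrices and the idempotents, with [Q]
    absorbing the customary factor n^-1. *)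
Definition dist_mx j : 'M[C]_n := \matrix_(x, y) (d x y == j)%:R.

Local Notation a := dist_mx.
Local Notation e1 := (inord 1 : 'I_D.+1).

Hypothesis D0 : (0 < D)%N.
Hypothesis dC : forall x y, d x y = d y x.
Hypothesis d_eq0 : forall x y, (d x y == ord0) = (x == y).
Hypothesis d_onto : forall j, exists x y, d x y = j.
Hypothesis pE : forall x y i j, #|[set z | (d x z == i) && (d z y == j)]| = p (d x y) i j.
Hypothesis p_tri : triangle_conditions p.
Hypothesis bip : exists c : 'I_n -> bool, forall x y, d x y = e1 -> c x != c y.
Hypothesis idE : forall i j, E i *m E j = if i == j then E i else 0.
Hypothesis sumE : \sum_i E i = 1%:M.
Hypothesis E0 : E ord0 = n%:R^-1 *: const_mx 1.
Hypothesis E_neq0 : forall i, E i != 0.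
Hypothesis qE : forall i j, map2_mx *%R (E i) (E j) = n%:R^-1 *: \sum_h q h i j *: E h.
Hypothesis q_tri : triangle_conditions q.
Hypothesis aP : forall j, a j = \sum_i P j i *: E i.
Hypothesis EQ : forall i, E i = \sum_j Q i j *: a j.

Lemma val_e1 : e1 = 1%N :> nat. Proof. by rewrite inordK. Qed.

Lemma n_neq0 : n%:R != 0 :> C.
Proof.
rewrite pnatr_eq0 -lt0n; have [x _] := d_onto ord0.
exact: leq_ltn_trans (ltn_ord x).
Qed.

Lemma E_entry i x y : E i x y = Q i (d x y).
Proof.
rewrite EQ summxE (bigD1 (d x y)) //= !mxE eqxx mulr1 big1 ?addr0 // => j jd.
by rewrite !mxE eq_sym (negbTE jd) mulr0.
Qed.

Lemma dist_mxE j i : a j *m E i = P j i *: E i.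
Proof.
rewrite aP mulmx_suml (bigD1 i) //= -scalemxAl idE eqxx big1 ?addr0 // => k ki.
by rewrite -scalemxAl idE (negbTE ki) scaler0.
Qed.

Lemma E_dist_mx j i : E i *m a j = P j i *: E i.
Proof.
rewrite aP mulmx_sumr (bigD1 i) //= -scalemxAr idE eqxx big1 ?addr0 // => k ki.
by rewrite -scalemxAr idE eq_sym (negbTE ki) scaler0.
Qed.

Lemma dist_mx_mul i j : a i *m a j = \sum_h (p h i j)%:R *: a h.
Proof.
apply/matrixP => x y; rewrite mxE summxE (bigD1 (d x y)) //= !mxE eqxx mulr1.
rewrite [X in _ = _ + X]big1 => [|h hd]; last first.
  by rewrite !mxE eq_sym (negbTE hd) mulr0.
rewrite addr0 -pE -sum1_card natr_sum [RHS]big_mkcond /=; apply: eq_bigr => z _.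
by rewrite !mxE inE; case: (_ == _); case: (_ == _); rewrite ?mulr1 ?mulr0.
Qed.

(** If the eigenvalues of [a e1] agree, those of all [a j] agree by the recursion. Then [E i], a
    combination of the [a j], acts by one scalar on [E i] and [E k], although it fixes the first and
    kills the second. *)
Lemma P_inj i k : P e1 i = P e1 k -> i = k.
Proof.
move=> Pik; apply/eqP/negPn/negP => ik.
have eqPik : forall j, P j i = P j k.
  apply: (@three_term_separation _ _ P (fun h j => (p h e1 j)%:R) e1) => //.
  - move=> j l; have := congr1 (mulmx^~ (E l)) (dist_mx_mul e1 j).
    rewrite -mulmxA dist_mxE -scalemxAr dist_mxE scalerA mulmx_suml.
    under eq_bigr do rewrite -scalemxAl dist_mxE scalerA.
    rewrite -scaler_suml => /eqP; rewrite -subr_eq0 -scalerBl scaler_eq0.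
    by rewrite (negbTE (E_neq0 l)) orbF subr_eq0 mulrC => /eqP.
  - move=> h j hj; have [+ _] := p_tri h e1 j; rewrite val_e1 add1n.
    by move=> -> //; rewrite hj.
  - move=> h j hj; have [_ +] := p_tri h e1 j; rewrite val_e1 add1n hj eqxx.
    by move=> /(_ isT) /eqP; rewrite pnatr_eq0.
  have a0 : a ord0 = 1%:M.
    by apply/matrixP => x y; rewrite !mxE d_eq0.
  have P0 l : P ord0 l = 1.
    have := dist_mxE ord0 l; rewrite a0 mul1mx => /eqP.
    rewrite -{1}[E l]scale1r -subr_eq0 -scalerBl scaler_eq0 (negbTE (E_neq0 l)).
    by rewrite orbF subr_eq0 => /eqP <-.
  by rewrite !P0.
have EE l : E i *m E l = (\sum_j Q i j * P j l) *: E l.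
  rewrite {1}EQ mulmx_suml scaler_suml; apply: eq_bigr => j _.
  by rewrite -scalemxAl dist_mxE scalerA.
have := EE k; rewrite idE (negbTE ik) => /esym/eqP; rewrite scaler_eq0.
rewrite (negbTE (E_neq0 k)) orbF => /eqP c0.
have := EE i; under eq_bigr do rewrite eqPik.
by rewrite c0 scale0r idE eqxx => /eqP; rewrite (negbTE (E_neq0 i)).
Qed.

(** The dual argument for the entrywise product: otherwise [a i] would take the same value on the
    classes [i] and [k]. *)
Lemma Q_inj i k : Q e1 i = Q e1 k -> i = k.
Proof.
move=> Qik; apply/eqP/negPn/negP => ik.
have eqQ : forall j, Q j i = Q j k.
  apply: (@three_term_separation _ _ Q (fun h j => n%:R^-1 * q h e1 j) e1) => //.
  - move=> j l; have [x [y <-]] := d_onto l.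
    have /matrixP/(_ x y) := qE e1 j; rewrite !mxE !E_entry => ->.
    rewrite summxE mulr_sumr; apply: eq_bigr => h _.
    by rewrite !mxE E_entry mulrA.
  - move=> h j hj; have [+ _] := q_tri h e1 j; rewrite val_e1 add1n.
    by move=> -> //; rewrite ?mulr0 // hj.
  - move=> h j hj; have [_ +] := q_tri h e1 j; rewrite val_e1 add1n hj eqxx.
    by move=> /(_ isT) /eqP ?; rewrite mulf_neq0 ?invr_eq0 ?n_neq0.
  have Q0 l : Q ord0 l = n%:R^-1.
    by have [x [y <-]] := d_onto l; rewrite -E_entry E0 !mxE mulr1.
  by rewrite !Q0.
have aa l : (l == i)%:R = \sum_j P i j * Q j l.
  have [x [y <-]] := d_onto l; have /matrixP/(_ x y) := aP i.
  rewrite !mxE summxE => ->; apply: eq_bigr => j _.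
  by rewrite !mxE E_entry.
have := aa k; rewrite eq_sym (negbTE ik); have := aa i.
under eq_bigr do rewrite eqQ.
by move=> <-; rewrite eqxx => /eqP; rewrite eq_sym oner_eq0.
Qed.

Lemma scaled_idem_id (M N : 'M[C]_n) (c : C) :
  M *m M = M -> N *m N = N -> M != 0 -> M = c *: N -> M = N.
Proof.
move=> idM idN M0 McN.
have := idM; rewrite {1}McN {1}McN -scalemxAl -scalemxAr idN.
rewrite -McN {2}McN => /eqP; rewrite -subr_eq0 McN.
rewrite -[X in _ - X]scale1r -scalerBl scaler_eq0 -McN (negbTE M0) orbF subr_eq0.
by move/eqP => c1; rewrite McN c1 scale1r.
Qed.

(** The conjugate [M] is again an idempotent in the span of the [a j], and it is proportional to
    [E i] once [E i *m M] is seen to be nonzero. *)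
Lemma E_real i x y : (E i x y)^* = E i x y.
Proof.
pose M := map_mx Num.conj (E i).
have idM : M *m M = M by rewrite -map_mxM idE eqxx.
have Ma : M = \sum_j (Q i j)^* *: a j.
  rewrite /M EQ rmorph_sum /=; apply: eq_bigr => j _.
  by apply/matrixP => u v; rewrite !mxE rmorphM /= conjC_nat.
have EM : E i *m M = M *m E i.
  rewrite Ma mulmx_suml mulmx_sumr; apply: eq_bigr => j _.
  by rewrite -scalemxAl -scalemxAr dist_mxE E_dist_mx.
have [c cE] : exists c, E i *m M = c *: E i.
  exists (\sum_j (Q i j)^* * P j i).
  rewrite Ma mulmx_sumr scaler_suml; apply: eq_bigr => j _.
  by rewrite -scalemxAr E_dist_mx scalerA.
(* As [E i] is symmetric, the diagonal entries of [E i *m M] are the squared norms of its rows. *)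
have c0 : c != 0.
  apply/eqP => c0; move/eqP: (E_neq0 i); apply; apply/matrixP => u v.
  have /matrixP/(_ u u) := cE; rewrite c0 scale0r !mxE => /eqP.
  rewrite psumr_eq0 => [/allP/(_ v)|w _]; rewrite mxE.
    rewrite mem_index_enum => /(_ isT) /=.
    by rewrite (E_entry i v u) dC -E_entry mul_conjC_eq0 => /eqP.
  by rewrite (E_entry i w u) dC -E_entry mul_conjC_ge0.
have cM : M *m E i = c^* *: M.
  have MK : map_mx Num.conj M = E i.
    by apply/matrixP => u v; rewrite !mxE conjCK.
  by rewrite -MK -map_mxM cE map_mxZ.
have ME : M = (c^*^-1 * c) *: E i.
  by rewrite -scalerA -cE EM cM scalerA mulVf ?scale1r // conjC_eq0.
suff /matrixP/(_ x y) : M = E i by rewrite mxE.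
apply: scaled_idem_id ME => //; first by rewrite idE eqxx.
apply: contra (E_neq0 i) => /eqP M0; move: cE; rewrite M0 mulmx0 => /esym/eqP.
by rewrite scaler_eq0 (negbTE c0).
Qed.

(** * Dual idempotents at a base vertex *)

Variable x0 : 'I_n.

Definition dual_idem j : 'M[C]_n := diag_mx (\row_w (d x0 w == j)%:R).

Local Notation Es := dual_idem.

Lemma dual_idem_mul i j : Es i *m Es j = if i == j then Es i else 0.
Proof.
rewrite /Es mul_diag_mx; apply/matrixP => x y.
case: (i =P j) => [<-|ij]; rewrite !mxE; case: (x == y); rewrite ?mulr0 ?mulr1n //.
  by case: eqP; rewrite ?mulr1 ?mulr0.
by case: eqP => [->|]; rewrite ?mul0r // (negbTE (introN eqP ij)) mulr0.
Qed.

Lemma dual_idem_comb f : \sum_j f j *: Es j = diag_mx (\row_w f (d x0 w)).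
Proof.
apply/matrixP => x y; rewrite summxE (bigD1 (d x0 x)) //= !mxE eqxx mulrnAr mulr1.
rewrite big1 ?addr0 // => j jd.
by rewrite !mxE eq_sym (negbTE jd) mul0rn mulr0.
Qed.

Lemma dual_idem_sum : \sum_j Es j = 1%:M.
Proof.
under eq_bigr do rewrite -[Es _]scale1r.
by rewrite (dual_idem_comb (fun=> 1)); apply/matrixP => x y; rewrite !mxE.
Qed.

Lemma dual_idem_tridiagonal (i j : 'I_D.+1) : (i.+1 < j)%N || (j.+1 < i)%N ->
  Es i *m a e1 *m Es j = 0.
Proof.
move=> ij; rewrite /Es mul_diag_mx mul_mx_diag; apply/matrixP => y z; rewrite !mxE.
case: eqP => [yi|]; last by rewrite !mul0r.
case: eqP => [yz|]; last by rewrite mulr0 mul0r.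
case: eqP => [zj|]; last by rewrite mulr0.
have := pE x0 y j e1; have [p0 _] := p_tri (d x0 y) j e1.
rewrite p0; last by rewrite yi val_e1; lia.
by move/eqP; rewrite cards_eq0 => /eqP/setP/(_ z); rewrite !inE zj dC yz !eqxx.
Qed.

Lemma idem_tridiagonal (i j : 'I_D.+1) : (i.+1 < j)%N || (j.+1 < i)%N ->
  E i *m (\sum_k Q e1 k *: Es k) *m E j = 0.
Proof.
move=> ij; rewrite dual_idem_comb.
set b := \row_w _; have bE w : b 0 w = E e1 x0 w by rewrite mxE E_entry.
clearbody b; have bC w : (b 0 w)^* = b 0 w by rewrite bE E_real.
set M := _ *m _; pose T := E j *m diag_mx b *m E i.
have MT x y : T y x = (M x y)^*.
  rewrite /T /M -mulmxA mul_diag_mx mul_mx_diag !mxE rmorph_sum /=.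
  apply: eq_bigr => w _; rewrite !mxE !rmorphM /= bC !E_real.
  by rewrite mulrC (mulrC (b 0 w)) !E_entry (dC y) (dC x).
(* T is the adjoint of M, so this trace is the squared norm of M; it equals
   n^-1 q^1_{ij} E_1(x_0, x_0). *)
have tr0 : \tr (M *m T) = 0.
  have -> : \tr (M *m T) = \tr (E i *m diag_mx b *m (E j *m diag_mx b)).
    have -> : M *m T = E i *m (diag_mx b *m E j *m diag_mx b *m E i).
      by rewrite /M /T !mulmxA -(mulmxA _ (E j) (E j)) idE eqxx.
    by rewrite mxtrace_mulC -(mulmxA _ (E i) (E i)) idE eqxx mxtrace_mulC !mulmxA.
  rewrite !mul_mx_diag /mxtrace.
  (* The entries [b 0 w] are [E e1 x0 w], so the double sum is the entry at [x0, x0] of E_1 (E_i o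
     E_j) E_1, with o the entrywise product. *)
  have -> : \sum_x ((\matrix_(k, l) (E i k l * b 0 l) : 'M_n) *m
      (\matrix_(k, l) (E j k l * b 0 l) : 'M_n)) x x =
      (E e1 *m map2_mx *%R (E i) (E j) *m E e1) x0 x0.
    rewrite [RHS]mxE; apply: eq_bigr => x _; rewrite !mxE mulr_suml.
    apply: eq_bigr => w _; rewrite !mxE !bE (E_entry e1 x) dC -E_entry.
    rewrite (E_entry i x) (E_entry j w x) (dC x w) -!E_entry.
    rewrite [in RHS]mulrA [in RHS](mulrC (E e1 x0 w)) -!mulrA.
    by congr (_ * _); rewrite mulrCA.
  rewrite qE -scalemxAr -scalemxAl mulmx_sumr mulmx_suml (bigD1 e1) //=.
  rewrite -scalemxAr idE eqxx -scalemxAl idE eqxx.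
  have [q0 _] := q_tri e1 i j; rewrite q0; last by rewrite val_e1; lia.
  rewrite scale0r add0r big1 ?scaler0 => [|h h1]; first by rewrite mxE.
  by rewrite -scalemxAr idE eq_sym (negbTE h1) scaler0 mul0mx.
apply/matrixP => x y; rewrite [RHS]mxE; apply/eqP; rewrite -mul_conjC_eq0.
have /eqP := tr0; rewrite /mxtrace psumr_eq0 => [/allP/(_ x)|u _]; last first.
  by rewrite mxE sumr_ge0 // => v _; rewrite MT mul_conjC_ge0.
rewrite mem_index_enum => /(_ isT) /=; rewrite mxE.
rewrite psumr_eq0 => [/allP/(_ y)|v _]; last by rewrite MT mul_conjC_ge0.
by rewrite mem_index_enum MT => /(_ isT).
Qed.

Lemma dist_parity : exists c : 'I_n -> bool, forall x y, odd (d x y) = c x (+) c y.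
Proof.
have [c cP] := bip; exists c => x y.
move: {2}(nat_of_ord (d x y)) (erefl (nat_of_ord (d x y))) => m.
elim: m x y => [|m IH] x y dm; rewrite dm /=.
  have := d_eq0 x y; rewrite -val_eqE /= dm eqxx => /esym/eqP->.
  by rewrite addbb.
have mD : (m < D.+1)%N by rewrite (leq_trans _ (ltn_ord (d x y))) // dm.
(* Since p^(m+1)_(1,m) is nonzero, some neighbour [z] of [x] lies at distance [m] from [y]; stepping
   to it flips the colour. *)
have := pE x y e1 (Ordinal mD); have [_] := p_tri (d x y) e1 (Ordinal mD).
rewrite val_e1 dm add1n eqxx => /(_ isT) pn0 /eqP; rewrite eq_sym => /eqP pc.
have : (0 < #|[set z | (d x z == e1) && (d z y == Ordinal mD)]|)%N.
  by rewrite -pc lt0n; apply/eqP.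
case/card_gt0P => z; rewrite inE => /andP[/eqP /cP cxz /eqP dzy].
have := IH z y; rewrite dzy => /(_ erefl) ->; move: cxz.
by case: (c x); case: (c z); case: (c y).
Qed.

(** * The sign idempotent and the reversal of the ordering *)

Let g w : C := (-1) ^+ d x0 w.

Lemma dist_sign x y : (-1) ^+ d x y = g x * g y.
Proof.
have [c cP] := dist_parity; rewrite /g -signr_odd -(signr_odd _ (d x0 x)).
rewrite -(signr_odd _ (d x0 y)) !cP -signr_addb; congr (_ ^+ _).
by case: (c x); case: (c y); case: (c x0).
Qed.

Lemma sign_sqr x : g x * g x = 1.
Proof. by rewrite /g -expr2 sqrr_sign. Qed.

Let S : 'M[C]_n := diag_mx (\row_w g w).

Lemma sign_mxK : S *m S = 1%:M.
Proof.
rewrite /S mul_diag_mx; apply/matrixP => x y; rewrite !mxE.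
by case: eqP => [->|_]; rewrite ?mulr0 // !mulr1n sign_sqr.
Qed.

Let J : 'M[C]_n := \matrix_(x, y) (n%:R^-1 * (-1) ^+ d x y).

(** [J] is a multiple of an outer product of the sign vector with itself. *)
Lemma sign_idem_sandwich (M : 'M[C]_n) : exists c, J *m M *m J = c *: J.
Proof.
pose v := \row_w g w.
have JE : J = n%:R^-1 *: (v^T *m v).
  by apply/matrixP => x y; rewrite !mxE big_ord1 !mxE dist_sign.
exists (n%:R^-1 * (v *m M *m v^T) 0 0).
rewrite JE -!scalemxAl -scalemxAr !mulmxA -2!(mulmxA v^T).
rewrite [X in v^T *m X]mx11_scalar mul_mx_scalar -!scalemxAl !scalerA.
by congr (_ *: _); rewrite mulrC.
Qed.

Lemma sign_idem_sqr : J *m J = J.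
Proof.
apply/matrixP => x y; rewrite !mxE.
under eq_bigr => z _.
  rewrite !mxE !dist_sign mulrACA -(mulrA (g x)) (mulrA (g z)) sign_sqr mul1r.
  over.
rewrite sumr_const card_ord -[LHS]mulr_natl dist_sign !mulrA mulfV ?n_neq0 //.
by rewrite mul1r.
Qed.

Lemma sign_idem_neq0 : J != 0.
Proof.
apply/eqP => /matrixP/(_ x0 x0); rewrite !mxE => /eqP.
by rewrite mulf_eq0 invr_eq0 (negbTE n_neq0) signr_eq0.
Qed.

(** [J] lies in the span of the [a j], so it acts on each [E i] by a scalar, nonzero for some [t].
    Sandwiching [E t] by the rank one matrix [J] makes the two proportional. *)
Lemma sign_idemP : exists t, E t = J.
Proof.
have Ja : J = \sum_(j < D.+1) (n%:R^-1 * (-1) ^+ j) *: a j.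
  apply/matrixP => x y; rewrite summxE (bigD1 (d x y)) //= !mxE eqxx mulr1.
  by rewrite big1 ?addr0 // => j jd; rewrite !mxE eq_sym (negbTE jd) mulr0.
pose c i := \sum_(j < D.+1) n%:R^-1 * (-1) ^+ j * P j i.
have EJ i : E i *m J = c i *: E i.
  rewrite Ja mulmx_sumr scaler_suml; apply: eq_bigr => j _.
  by rewrite -scalemxAr E_dist_mx scalerA.
have JE i : J *m E i = c i *: E i.
  rewrite Ja mulmx_suml scaler_suml; apply: eq_bigr => j _.
  by rewrite -scalemxAl dist_mxE scalerA.
case: (pickP (fun t : 'I_D.+1 => c t != 0)) => [t ct|c0]; last first.
  case/eqP: sign_idem_neq0; rewrite -[LHS]mul1mx -sumE mulmx_suml big1 // => i _.
  by rewrite EJ; have /negbT := c0 i; rewrite negbK => /eqP->; rewrite scale0r.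
exists t; have [l] := sign_idem_sandwich (E t).
rewrite JE -scalemxAl EJ scalerA => El.
apply: (@scaled_idem_id _ _ ((c t * c t)^-1 * l)).
- by rewrite idE eqxx.
- exact: sign_idem_sqr.
- exact: E_neq0.
- by rewrite -scalerA -El scalerA mulVf ?scale1r // mulf_neq0.
Qed.

(** Conjugation by [S] is the entrywise product with [n%:R *: J]. *)
Lemma sign_conjE t i : E t = J -> S *m E i *m S = \sum_h q h t i *: E h.
Proof.
move=> tJ; apply: (scalerI (invr_neq0 n_neq0)); rewrite -qE tJ.
rewrite /S mul_diag_mx mul_mx_diag; apply/matrixP => x y.
by rewrite !mxE dist_sign -[RHS]mulrA; congr (_ * _); rewrite mulrAC.
Qed.

(** With [W] the conjugate of [E i], [E h *m W] is a nonzero multiple of [E h], and conjugating the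
    expansion for [h] shows it is also a multiple of [W]. *)
Lemma sign_conj t i h : E t = J -> q h t i != 0 -> S *m E i *m S = E h.
Proof.
move=> tJ q0; set W := S *m E i *m S.
have WW : W *m W = W.
  by rewrite /W !mulmxA -(mulmxA _ S S) sign_mxK mulmx1 -(mulmxA S (E i)) idE eqxx.
have EW : E h *m W = q h t i *: E h.
  rewrite /W (sign_conjE i tJ) mulmx_sumr (bigD1 h) //= -scalemxAr idE eqxx.
  rewrite big1 ?addr0 // => k kh.
  by rewrite -scalemxAr idE eq_sym (negbTE kh) scaler0.
have WE : S *m E h *m S *m E i = q i t h *: E i.
  rewrite (sign_conjE h tJ) mulmx_suml (bigD1 i) //= -scalemxAl idE eqxx.
  rewrite big1 ?addr0 // => k ki.
  by rewrite -scalemxAl idE (negbTE ki) scaler0.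
have EW' : E h *m W = q i t h *: W.
  transitivity (S *m (S *m E h *m S *m E i) *m S).
    by rewrite /W !mulmxA sign_mxK mul1mx.
  by rewrite WE -scalemxAr -scalemxAl.
apply/esym/(@scaled_idem_id _ _ ((q h t i)^-1 * q i t h)) => //.
- by rewrite idE eqxx.
- by rewrite -scalerA -EW' EW scalerA mulVf ?scale1r.
Qed.

(** If 0 < t < D, two Krein parameters, at [t.-1] and [t.+1], are nonzero, so the conjugate of E_1
    would equal two distinct idempotents. If t = 0, the entries of [J] would be constant, but they
    change sign at distance 1. *)
Lemma sign_idem_last : E ord_max = J.
Proof.
have [t tJ] := sign_idemP; suff -> : ord_max = t by [].
have tle : (t <= D)%N by rewrite -ltnS.
apply/val_inj/eqP; rewrite /= eqn_leq tle andbT leqNgt.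
apply/negP => tD; have t0 : (0 < t)%N.
  rewrite lt0n; apply/eqP => t0; have [x [y dxy]] := d_onto e1.
  have tz : t = ord0 by exact: val_inj.
  move: tJ; rewrite tz E0 => /matrixP/(_ x y); rewrite !mxE dxy val_e1 expr1 mulr1.
  rewrite mulrN1 => /eqP; rewrite -subr_eq0 opprK -mulr2n mulrn_eq0 invr_eq0.
  by rewrite (negbTE n_neq0).
have h1 : (t.-1 < D.+1)%N by lia.
have h2 : (t.+1 < D.+1)%N by lia.
have q1 : q (Ordinal h1) t e1 != 0.
  by apply/eqP; have [_] := q_tri (Ordinal h1) t e1; apply; rewrite val_e1 /=; lia.
have q2 : q (Ordinal h2) t e1 != 0.
  by apply/eqP; have [_] := q_tri (Ordinal h2) t e1; apply; rewrite val_e1 /=; lia.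
have e : E (Ordinal h1) = E (Ordinal h2).
  by rewrite -(sign_conj tJ q1) -(sign_conj tJ q2).
have := idE (Ordinal h1) (Ordinal h2); rewrite -e idE eqxx -val_eqE /=.
case: eqP => [|_ /eqP]; first lia.
by rewrite (negbTE (E_neq0 _)).
Qed.

Lemma sign_conj_rev i : S *m E i *m S = E (rev_ord i).
Proof.
apply: (sign_conj sign_idem_last); apply/eqP.
(* The relevant triangle equality is D = (D - i) + i. *)
have [_] := q_tri (rev_ord i) ord_max i; apply; rewrite /= subSS.
have := ltn_ord i; lia.
Qed.

Lemma rank_rev i : \rank (E (rev_ord i)) = \rank (E i).
Proof.
have S1 : S \in unitmx by case: (mulmx1_unit sign_mxK).
by rewrite -sign_conj_rev mxrankMfree ?row_free_unit // eqmxMfull // row_full_unit.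
Qed.

Lemma rank_mono (i j : 'I_D.+1) : j = i.+1 :> nat -> (2 * i < D)%N ->
  (\rank (E i) <= \rank (E j))%N.
Proof.
move=> ji iD.
have inj (f : 'I_D.+1 -> C) : (forall k l, f k = f l -> k = l) ->
    forall k l, (k <= D -> l <= D -> f (inord k) = f (inord l) -> k = l)%N.
  move=> f_inj k l kD lD /f_inj /(congr1 val) /=.
  by rewrite !inordK.
have spE (f : 'I_D.+1 -> C) (G : 'I_D.+1 -> 'M[C]_n) :
    spectral D (fun k => f (inord k)) (extend G) = \sum_k f k *: G k.
  by rewrite extend_spectral; apply: eq_bigr => k _; rewrite inord_val.
suff sys : td_system D (fun k => P e1 (inord k)) (fun k => Q e1 (inord k))
    (fun k => (-1) ^+ k) (extend E) (extend Es).
  have := td_system_rank_mono (inj _ P_inj) (inj _ Q_inj) _ sys iD.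
  by rewrite -ji !extend_ord; apply => k; rewrite signr_eq0.
have SE : spectral D (fun k => (-1) ^+ k) (extend Es) = S.
  by rewrite extend_spectral (dual_idem_comb (fun k : 'I_D.+1 => (-1) ^+ k)).
split.
- exact: extend_idem_system.
- exact: (extend_idem_system dual_idem_mul dual_idem_sum).
- move=> k l kl; rewrite spE -aP /extend.
  case: (leqP k D) => kD; last by rewrite !mul0mx.
  case: (leqP l D) => lD; last by rewrite mulmx0.
  by rewrite dual_idem_tridiagonal // !inordK.
- move=> k l kl; rewrite spE /extend.
  case: (leqP k D) => kD; last by rewrite !mul0mx.
  case: (leqP l D) => lD; last by rewrite mulmx0.
  by rewrite idem_tridiagonal // !inordK.
- move=> k kD; rewrite SE /extend kD leq_subr.
  have -> : inord (D - k) = rev_ord (inord k) :> 'I_D.+1.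
    by apply: val_inj; rewrite /= !inordK ?subSS // ltnS leq_subr.
  by rewrite -sign_conj_rev -!mulmxA sign_mxK mulmx1.
Qed.

End Scheme.

(** * Unimodality and passage from the abstract scheme *)

Lemma unimodal_sym (D : nat) (m : 'I_D.+1 -> nat) :
    (forall i, m (rev_ord i) = m i) ->
    (forall i j : 'I_D.+1, j = i.+1 :> nat -> (2 * i < D)%N -> (m i <= m j)%N) ->
  unimodal m.
Proof.
move=> mrev mS.
(* The bound is [D.+1] because for odd [D] the reversal of the peak index [D./2] is (D + 1) / 2. *)
have mono (i j : 'I_D.+1) : (i <= j)%N -> (2 * j <= D.+1)%N -> (m i <= m j)%N.
  case: j => j jD; elim: j jD => [|j IH] jD /=.
    by rewrite leqn0 => /eqP i0 _; rewrite (_ : i = Ordinal jD) //; exact: val_inj.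
  rewrite leq_eqVlt => /orP[/eqP ij|ij] jD2.
    by rewrite (_ : i = Ordinal jD) //; exact: val_inj.
  apply: leq_trans (IH (ltnW jD) _ _) (mS _ _ _ _) => //=; lia.
have kD : (D./2 < D.+1)%N by lia.
exists (Ordinal kD); split=> i j /= /andP[ij jk].
  by apply: mono => //; lia.
rewrite -(mrev i) -(mrev j); apply: mono => /=; lia.
Qed.

Theorem corollary1p4 (R : realType) (X : finType) (D : nat)
    (Y : assoc_scheme X D) (E : 'I_D.+1 -> 'M[R[i]%C]_#|X|)
    (hP : bipartite_P_polynomial Y)
    (hE : primitive_idempotents Y E)
    (hQ : Q_polynomial E) :
  unimodal (fun i => \rank (E i)).
Proof.
have [s [s0 Pp [A bipA]]] := hP.
have [basE idE sumE E0] := hE.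
have [q qE q_tri] := hQ.
have clsP x y : exists j, Y (s j) x y.
  have [j [Yj _]] := cls_partition Y x y.
  by exists (s^-1 j)%g; rewrite permKV.
have clsU x y j k : Y (s j) x y -> Y (s k) x y -> j = k.
  move=> Yj Yk; have [l [_ lU]] := cls_partition Y x y.
  by apply: (@perm_inj _ s); rewrite -(lU _ Yj) -(lU _ Yk).
(* The class index is read in the ordering [s], so that [d] is the distance in the graph of the
   relation [Y (s (inord 1))]. *)
pose d (x y : 'I_#|X|) := xchoose (clsP (enum_val x) (enum_val y)).
have dY x y j : Y (s j) (enum_val x) (enum_val y) = (d x y == j).
  have dx := xchooseP (clsP (enum_val x) (enum_val y)).
  apply/idP/eqP => [|<- //]; exact: clsU.
have aE j : assoc_mx R[i]%C Y (s j) = dist_mx R[i]%C d j.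
  by apply/matrixP => x y; rewrite !mxE dY.
have E_neq0 i : E i != 0.
  have /andP[_ /free_not0 fE] := basE.
  apply: contraTneq isT => Ei0; have := fE 0; rewrite eqxx => /(_ _) /negP[] //.
  by rewrite -Ei0; apply/tnthP; exists i; rewrite tnth_mktuple.
have [P aP] : exists P : 'I_D.+1 -> 'I_D.+1 -> R[i]%C, forall j,
    dist_mx R[i]%C d j = \sum_i P j i *: E i.
  exists (fun j i => coord [tuple E i | i < D.+1] i (dist_mx R[i]%C d j)) => j.
  have : dist_mx R[i]%C d j \in bose_mesner R[i]%C Y.
    rewrite -aE; apply: memv_span; apply/tnthP; exists (s j).
    by rewrite tnth_mktuple.
  move=> /(coord_basis basE) {1}->; apply: eq_bigr => i _.
  by rewrite -tnth_nth tnth_mktuple.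
have [Q EQ] : exists Q : 'I_D.+1 -> 'I_D.+1 -> R[i]%C, forall i,
    E i = \sum_j Q i j *: dist_mx R[i]%C d j.
  pose T := [tuple assoc_mx R[i]%C Y i | i < D.+1].
  exists (fun i j => coord T (s j) (E i)) => i.
  have : E i \in bose_mesner R[i]%C Y.
    rewrite -(span_basis basE); apply: memv_span; apply/tnthP; exists i.
    by rewrite tnth_mktuple.
  move=> /coord_span {1}->; rewrite (reindex_inj (@perm_inj _ s)).
  by apply: eq_bigr => j _; rewrite -tnth_nth tnth_mktuple aE.
have d_eq0 x y : (d x y == ord0) = (x == y).
  by rewrite -dY s0 cls0 (inj_eq enum_val_inj).
have dC x y : d x y = d y x.
  by apply/eqP; rewrite -dY cls_sym dY.
have d_onto j : exists x y, d x y = j.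
  have [x [y]] := cls_nonempty Y (s j); rewrite -(enum_rankK x) -(enum_rankK y).
  by rewrite dY => /eqP; exists (enum_rank x), (enum_rank y).
have pE x y i j : #|[set z | (d x z == i) && (d z y == j)]| =
    inum Y (s (d x y)) (s i) (s j).
  have Yd : Y (s (d x y)) (enum_val x) (enum_val y) by rewrite dY.
  rewrite -(inumP (s i) (s j) Yd) -(card_imset _ enum_val_inj).
  apply: eq_card => z; rewrite inE -(enum_rankK z) (mem_imset _ _ enum_val_inj).
  by rewrite inE !dY.
have bip : exists c : 'I_#|X| -> bool, forall x y, d x y = inord 1 -> c x != c y.
  by exists (fun x => enum_val x \in A) => x y /eqP; rewrite -dY; exact: bipA.
have D0 := scheme_classes Y.
have [x0 _] := d_onto ord0.
apply: unimodal_sym => [i|i j].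
  exact: (rank_rev D0 d_eq0 d_onto pE Pp bip idE sumE E0 E_neq0 qE q_tri aP x0).
exact: (rank_mono D0 dC d_eq0 d_onto pE Pp bip idE sumE E0 E_neq0 qE q_tri aP EQ x0).
Qed.
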